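(* Assume the explicit abc conjecture: whenever $a,b,c$ are pairwise coprime non-zero integers with $a+b=c$, one has $c<N(abc)^{7/4}$, where $N(x)=\prod_{p\mid x}p$ denotes the product of the distinct primes dividing $x$. Let $t\geq 3$ be an integer and let $c>0$ be a fixed positive integer. Consider tuples of integers $(a_1,\dots,a_t,n_1,n_2)$ with $a_1\geq a_2\geq\cdots\geq a_t\geq 2$, $n_1\geq n_2\geq 2$ and $a_l\neq n_j$ for all $l,j$, satisfying $$\prod_{l=1}^t a_l! = n_1!\,n_2!.$$ Such a solution is called trivial if there is a pair $(l,j)$ with $|a_l-n_j|=1$, and nontrivial otherwise. For $2\leq i\leq t$ let $\mathcal{N}(c)_i$ be the set of nontrivial solutions with $n_1>a_1$, $n_2>a_i$ and $k_2/k_1\leq c$, where $k_1=n_1-a_1$ and $k_2=n_2-a_i$. (For such solutions, with $m_1=a_1+1$, $m_2=a_i+1$ and $\Delta(m,k)=m(m+1)\cdots(m+k-1)$, the equation is equivalent to $\prod_{l\neq 1,i}a_l!=\Delta(m_1,k_1)\Delta(m_2,k_2)$.) Then for every $2\leq i\leq t$ the set $\mathcal{N}(c)_i$ is finite. Consequently, the set $\mathcal{N}(c)=\bigcup_{i=2}^t\mathcal{N}(c)_i$ is finite, i.e. the equation $\prod_{l=1}^t a_l!=n_1!n_2!$ has only finitely many solutions in $\mathcal{N}(c)$.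
   Context: $N(x)$ denotes the algebraic radical of a non-zero integer $x$, i.e. the product of the distinct primes dividing $x$. The ''explicit abc conjecture'' is the hypothesis stated at the beginning of the claim. *)

(* Defs.v *)
From Stdlib Require Import Reals ZArith.
From mathcomp Require Import all_boot all_order all_algebra.
Set Implicit Arguments. Unset Strict Implicit. Unset Printing Implicit Defensive.
Import Order.TTheory GRing.Theory Num.Theory.

(* Algebraic radical of a natural number: product of its distinct prime divisors
   (rad 0 = 1 by convention; only used on non-zero arguments). *)
Definition rad (n : nat) : nat := (\prod_(p <- primes n) p)%N.

Definition radZ (x : Z) : Z := Z.of_nat (rad (Z.abs_nat x)).

Definition explicit_abc : Prop :=
  forall a b c : Z,
    a <> Z0 -> b <> Z0 -> c <> Z0 ->
    Z.gcd a b = Z.pos xH -> Z.gcd a c = Z.pos xH -> Z.gcd b c = Z.pos xH ->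
    Z.add a b = c ->
    Rlt (IZR c) (Rpower (IZR (radZ (Z.mul (Z.mul a b) c))) (Rdiv (INR 7) (INR 4))).

(* A tuple (a_1,...,a_t,n_1,n_2) is represented by (a, n1, n2) with
   a = [:: a_1; ...; a_t] : seq nat, so a_l = nth 0 a (l-1) (0-based below). *)
Definition solution (t : nat) (a : seq nat) (n1 n2 : nat) : bool :=
  [&& size a == t,
      sorted geq a,
      all (fun x => 2 <= x) a,
      n2 <= n1, 2 <= n2,
      all (fun x => (x != n1) && (x != n2)) a
    & (\prod_(x <- a) x`!) == n1`! * n2`!]%N.

Definition dist1 (x n : nat) : bool := (x.+1 == n) || (n.+1 == x).

Definition nontrivial (a : seq nat) (n1 n2 : nat) : bool :=
  all (fun x => ~~ dist1 x n1 && ~~ dist1 x n2) a.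

(* N(c)_i, with i given 0-based (paper's index i+1), 1 <= i <= t-1:
   k1 = n1 - a_1, k2 = n2 - a_{i+1}, condition k2 / k1 <= c. *)
Definition Nc_i (t c i : nat) (a : seq nat) (n1 n2 : nat) : Prop :=
  solution t a n1 n2 /\ nontrivial a n1 n2 /\
  (nth 0 a 0 < n1)%N /\ (nth 0 a i < n2)%N /\
  ((((n2 - nth 0 a i)%N)%:Q / ((n1 - nth 0 a 0)%N)%:Q) <= c%:Q)%R.

Definition finite_sols (P : seq nat -> nat -> nat -> Prop) : Prop :=
  exists L : seq (seq nat * nat * nat),
    forall a n1 n2, P a n1 n2 -> (a, n1, n2) \in L.

(* Main.v *)
Require Import Defs.
From Stdlib Require Import Reals ZArith.
From mathcomp Require Import all_boot all_order all_algebra.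
From mathcomp Require Import zify.
(* Defs.rad is shadowed by a constant of all_algebra. *)
Import Defs.
Set Implicit Arguments. Unset Strict Implicit. Unset Printing Implicit Defensive.

(** Write n = n_1, k = n_1 - a_1 and l = n_2 - a_i, so that l <= c k, and let
    Q be the product of the remaining factorials, equal to
    (a_1 + 1)...n * (a_i + 1)...n_2. Comparing 2-adic valuations (Legendre),
    the sum of all a_j is n_1 + n_2 + O(log n). Every a_j is at most n - k, so
    strict convexity of log x! forces (1 + k/n)^k <= n^(O(log n)); hence
    k = o(n). Since the arguments of Q sum to at most k + l + O(log n), Q is at
    most (k + l + O(log n))!, which then sharpens this to k = O((log n)^2).

    Now abc applied to 1 + x = x + 1 for the k/2 disjoint pairs of consecutive
    integers in (a_1, n] bounds the product of the radicals of these integers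
    below by about n^(2k/7). That product divides k! rad((a_1 + 1)...n), where
    k! = n^(o(k)), and rad Q is n^(o(k)) because rad(a!) <= 4^a is
    smaller than any fixed power of a! while Q <= n^((c+1)k). As k >= 2, n is
    bounded. *)

(** * Radicals and divisibility *)

Lemma leq_wexp2r m n e : m <= n -> m ^ e <= n ^ e.
Proof. by case: e => // e; rewrite leq_exp2r. Qed.

Lemma coprime_prod_primes p (s : seq nat) :
  prime p -> p \notin s -> all prime s -> coprime p (\prod_(q <- s) q).
Proof.
move=> pp; elim: s => [|q s IHs]; first by rewrite big_nil coprimen1.
rewrite inE negb_or => /andP[pq ps] /= /andP[pq' /(IHs ps) H].
by rewrite big_cons coprimeMr H andbT prime_coprime // dvdn_prime2.
Qed.

Lemma prod_uniq_primes_dvdn (s : seq nat) n :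
  uniq s -> all prime s -> all (dvdn^~ n) s -> \prod_(p <- s) p %| n.
Proof.
elim: s => [|p s IHs] /=; first by rewrite big_nil dvd1n.
case/andP=> ps us /andP[pp pr] /andP[pn sn]; rewrite big_cons.
by rewrite Gauss_dvd ?pn ?IHs // coprime_prod_primes.
Qed.

Lemma primes_prime n : all prime (primes n).
Proof. by apply/allP => p; rewrite mem_primes => /andP[]. Qed.

Lemma rad_gt0 n : 0 < rad n.
Proof.
by rewrite /rad big_seq prodn_cond_gt0 // => p; rewrite mem_primes => /andP[/prime_gt0].
Qed.

Lemma rad_dvdn m n :
  (forall p, prime p -> p %| m -> p %| n) -> rad m %| n.
Proof.
move=> H; apply: prod_uniq_primes_dvdn; first exact: primes_uniq.
  by apply/allP => p; rewrite mem_primes => /andP[].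
by apply/allP => p; rewrite mem_primes => /and3P[pp _]; apply: H.
Qed.

Lemma prime_dvdn_rad p n : 0 < n -> prime p -> (p %| rad n) = (p %| n).
Proof.
move=> n0 pp; apply/idP/idP => [|pn].
  by move/dvdn_trans; apply; apply: rad_dvdn.
rewrite /rad (big_rem p) ?dvdn_mulr //.
by rewrite mem_primes pp n0.
Qed.

Lemma radM_leq m n : 0 < m -> 0 < n -> rad (m * n) <= rad m * rad n.
Proof.
move=> m0 n0; apply: dvdn_leq; first by rewrite muln_gt0 !rad_gt0.
apply: rad_dvdn => p pp; rewrite !Euclid_dvdM // !prime_dvdn_rad //.
Qed.

Lemma dvdn_leq_rad m n : 0 < n -> m %| n -> rad m <= rad n.
Proof.
move=> n0 mn; apply: dvdn_leq (rad_gt0 n) _.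
by apply: rad_dvdn => p pp pm; rewrite prime_dvdn_rad // (dvdn_trans pm).
Qed.

Lemma logn_rad_leq p n : logn p (rad n) <= (p %| n).
Proof.
have [pp|/negPf np] := boolP (prime p); last by rewrite lognE np.
have [n0|n0] := posnP n; first by rewrite n0 /rad big_nil logn1.
have [pn|pn] := boolP (p %| n); last first.
  by rewrite lognE (prime_dvdn_rad n0 pp) (negPf pn) !andbF.
have := primes_uniq n; have := primes_prime n.
have pin : p \in primes n by rewrite mem_primes pp n0.
have pe := perm_to_rem pin.
rewrite /rad (perm_big _ pe) (perm_uniq pe) (perm_all _ pe) /= big_cons.
move=> /andP[_ pr] /andP[ps _]; have cp := coprime_prod_primes pp ps pr.
by rewrite mulnC logn_Gauss //= logn_prime // eqxx.
Qed.

Lemma dvdn_from_log m n : 0 < m -> 0 < n ->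
  (forall p, prime p -> logn p m <= logn p n) -> m %| n.
Proof.
move=> m0 n0 H; apply/dvdn_partP => // p; rewrite mem_primes => /andP[pp _].
by rewrite p_part pfactor_dvdn // H.
Qed.

(** * Products of consecutive integers and of factorials *)

(** The quotient (A + k)! / A!, that is $\Delta(A+1,k)$. *)
Definition rise A k := \prod_(j < k) (A + j.+1).

Lemma riseS A k : rise A k.+1 = rise A k * (A + k.+1).
Proof. by rewrite /rise big_ord_recr. Qed.

Lemma rise0 A : rise A 0 = 1.
Proof. by rewrite /rise big_ord0. Qed.

Lemma fact_rise A k : (A + k)`! = A`! * rise A k.
Proof.
elim: k => [|k IHk]; first by rewrite rise0 addn0 muln1.
by rewrite riseS mulnA -IHk addnS factS mulnC.
Qed.

Lemma rise_fact n : n`! = rise 0 n.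
Proof. by rewrite -[LHS]/((0 + n)`!) fact_rise mul1n. Qed.

Lemma rise_gt0 A k : 0 < rise A k.
Proof. by rewrite /rise prodn_gt0 // => j; rewrite addnS. Qed.

Lemma rise_add A k l : rise A (k + l) = rise A k * rise (A + k) l.
Proof.
elim: l => [|l IHl]; first by rewrite addn0 rise0 muln1.
by rewrite addnS !riseS IHl -addnS addnA mulnA.
Qed.

Lemma rise_leq A k : rise A k <= (A + k) ^ k.
Proof.
rewrite /rise -[X in _ ^ X]card_ord -prod_nat_const; apply: leq_prod => j _.
by rewrite leq_add2l.
Qed.

Lemma rise_geq A k : A ^ k <= rise A k.
Proof.
rewrite /rise -[X in _ ^ X]card_ord -prod_nat_const; apply: leq_prod => j _.
by rewrite leq_addr.
Qed.

Lemma leq_rise A B k : A <= B -> rise A k <= rise B k.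
Proof. by move=> AB; apply: leq_prod => j _; rewrite leq_add2r. Qed.

Lemma fact_mul_leq m n : m`! * n`! <= (m + n)`!.
Proof.
by rewrite fact_rise leq_mul2l (rise_fact n) leq_rise ?orbT.
Qed.

Lemma prod_fact_leq (s : seq nat) : \prod_(x <- s) x`! <= (\sum_(x <- s) x)`!.
Proof.
elim: s => [|x s IHs]; first by rewrite !big_nil.
by rewrite !big_cons (leq_trans _ (fact_mul_leq _ _)) // leq_mul2l IHs orbT.
Qed.

Lemma prod_fact_gt0 (s : seq nat) : 0 < \prod_(x <- s) x`!.
Proof. by rewrite prodn_gt0 // => x; exact: fact_gt0. Qed.

(** * The 2-adic valuation of factorials *)

Lemma logn2_fact_double m : logn 2 (m.*2)`! = m + logn 2 m`!.
Proof.
elim: m => [|m IHm]; first by rewrite logn1.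
rewrite doubleS !factS !lognM ?muln_gt0 ?fact_gt0 // IHm.
rewrite -doubleS -mul2n lognM // logn_prime // eqxx.
have -> : logn 2 m.*2.+1 = 0 by rewrite lognE dvdn2 /= odd_double.
by rewrite -[RHS]/((m + (logn 2 m.+1 + logn 2 m`!)).+1); lia.
Qed.

Lemma logn2_fact_half n : logn 2 n`! = n./2 + logn 2 (n./2)`!.
Proof.
rewrite -[n in LHS]odd_double_half -logn2_fact_double.
case: (odd n) => //=; rewrite add1n factS lognM ?fact_gt0 //.
by rewrite lognE dvdn2 /= odd_double.
Qed.

Lemma logn2_fact_leq n : logn 2 n`! <= n.
Proof.
elim/ltn_ind: n => -[|n] IHn; first by rewrite logn1.
have h : n.+1./2 < n.+1 by lia.
by rewrite logn2_fact_half; have := IHn _ h; lia.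
Qed.

(** By Legendre, the defect n - v_2(n!) is the binary digit sum of n: each of the at most [L]
    halvings loses at most 1. *)
Lemma leq_logn2_fact L n : n < 2 ^ L -> n <= logn 2 n`! + L.
Proof.
elim: L n => [|L IHL] n; first by rewrite expn0; case: n.
rewrite expnS => nL; have /IHL : n./2 < 2 ^ L by lia.
by rewrite (logn2_fact_half n); lia.
Qed.

Lemma fact_leq_exp n : n`! <= n ^ n.
Proof. by rewrite rise_fact; exact: rise_leq. Qed.

(** * A Chebyshev bound for the product of the primes up to n *)

Lemma bin_odd_leq m : 'C(m.*2.+1, m) <= 4 ^ m.
Proof.
(* The two central coefficients are equal and both occur in the expansion of (1 + 1)^(2m+1). *)
have H: 'C(m.*2.+1, m) + 'C(m.*2.+1, m.+1) <= 2 ^ m.*2.+1.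
  rewrite -[2]/(1 + 1) expnDn.
  under eq_bigr => i _ do rewrite !exp1n !muln1.
  have h1 : m < m.*2.+2 by lia.
  have h2 : m.+1 < m.*2.+2 by lia.
  rewrite (bigD1 (Ordinal h1)) //= (bigD1 (Ordinal h2)) /=; first by lia.
  by rewrite -val_eqE /=; lia.
have E : 'C(m.*2.+1, m.+1) = 'C(m.*2.+1, m).
  by rewrite -[RHS]bin_sub; [congr binomial; lia | lia].
have F : 2 ^ m.*2.+1 = 2 * 4 ^ m by rewrite expnS -mul2n expnM.
by rewrite E F in H; lia.
Qed.

Lemma prime_dvdn_fact p n : prime p -> (p %| n`!) = (p <= n).
Proof.
move=> pp; apply/idP/idP => [|pn]; last by rewrite dvdn_fact // prime_gt0.
elim: n => [|n IHn]; first by rewrite Euclid_dvd1.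
rewrite factS Euclid_dvdM // => /orP[/dvdn_leq->//|/IHn pn].
exact: leqW.
Qed.

Definition primorial n := \prod_(0 <= p < n.+1 | prime p) p.

(** Erdős's induction: for n = 2m + 1, the primes in (m + 1, 2m + 1] all divide C(2m + 1, m); an
    even n > 2 contributes no new prime. *)
Lemma primorial_leq n : primorial n <= 4 ^ n.
Proof.
elim/ltn_ind: n => n IHn; rewrite /primorial.
case: n IHn => [|[|[|n]]] IHn; try by rewrite unlock.
have [o|e] := boolP (odd n.+3); last first.
  rewrite (big_cat_nat (n := n.+3)) //= [X in _ * X]big_mkcond big_nat1.
  case: ifP => [pp|_]; last by rewrite muln1 (leq_trans (IHn n.+2 _)) // leq_exp2l.
  by case: (even_prime pp) => // o; rewrite o in e.
set m := n.+3./2; have en : n.+3 = m.*2.+1 by rewrite -[LHS]odd_double_half o.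
have m0 : 0 < m by lia.
clearbody m.
rewrite (big_cat_nat (n := m.+2)) //=; last by lia.
have -> : 4 ^ n.+3 = 4 ^ m.+1 * 4 ^ m by rewrite -expnD; congr expn; lia.
apply: leq_mul; first by apply: IHn; lia.
apply: leq_trans (bin_odd_leq m).
apply: dvdn_leq; first by rewrite bin_gt0; lia.
rewrite -big_filter; apply: prod_uniq_primes_dvdn.
- by rewrite filter_uniq // iota_uniq.
- exact: filter_all.
apply/allP => p; rewrite mem_filter mem_index_iota => /and3P[pp lp up].
have: p %| (m.*2.+1)`! by rewrite dvdn_fact // prime_gt0 //=; lia.
rewrite -(bin_fact (m := m)); last by lia.
rewrite !Euclid_dvdM // => /or3P[//||].
- by rewrite prime_dvdn_fact // => ?; exfalso; lia.
- by rewrite prime_dvdn_fact // => ?; exfalso; lia.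
Qed.

Lemma rad_fact_leq n : rad n`! <= 4 ^ n.
Proof.
apply: leq_trans (primorial_leq n); apply: dvdn_leq.
  by rewrite prodn_cond_gt0 // => p; exact: prime_gt0.
apply: rad_dvdn => p pp; rewrite prime_dvdn_fact // => pn.
rewrite /primorial -big_filter (big_rem p) ?dvdn_mulr //.
by rewrite mem_filter pp mem_index_iota.
Qed.

(** * Radicals of consecutive integers and of products of factorials *)

Lemma logn_prod_ord p k (F : nat -> nat) : (forall j, 0 < F j) ->
  logn p (\prod_(j < k) F j) = \sum_(j < k) logn p (F j).
Proof.
move=> F0; elim: k => [|k IHk]; first by rewrite !big_ord0 logn1.
by rewrite !big_ord_recr /= lognM ?prodn_gt0 // IHk.
Qed.

Lemma sum_dvdn_rise p A k : 0 < p ->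
  \sum_(j < k) (p %| A + j.+1) + A %/ p = (A + k) %/ p.
Proof.
move=> p0; elim: k => [|k IHk]; first by rewrite big_ord0 addn0.
by rewrite big_ord_recr /= addnAC IHk addnS divnS // addnC.
Qed.

Lemma logn_fact_geq p k : prime p -> k %/ p <= logn p k`!.
Proof.
move=> pp; case: k => [|k]; first by rewrite div0n.
by rewrite logn_fact // big_ltn // expn1 leq_addr.
Qed.

(* A prime p divides at most [k/p] + 1 of the k consecutive factors, and
   v_p(k!) >= [k/p]. *)
Lemma prod_rad_dvdn A k :
  \prod_(j < k) rad (A + j.+1) %| k`! * rad (rise A k).
Proof.
apply: dvdn_from_log => [||p pp].
- by rewrite prodn_gt0 // => j; exact: rad_gt0.
- by rewrite muln_gt0 fact_gt0 rad_gt0.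
rewrite (logn_prod_ord _ _ (F := fun j => rad (A + j.+1))); last first.
  by move=> j; exact: rad_gt0.
rewrite lognM ?fact_gt0 ?rad_gt0 //.
have p0 := prime_gt0 pp.
have S : \sum_(j < k) logn p (rad (A + j.+1)) <= \sum_(j < k) (p %| A + j.+1).
  by apply: leq_sum => j _; exact: logn_rad_leq.
have [pr|pr] := boolP (p %| rise A k).
  have : 0 < logn p (rad (rise A k)).
    by rewrite logn_gt0 mem_primes pp rad_gt0 prime_dvdn_rad ?rise_gt0.
  have := sum_dvdn_rise A k p0; have := leq_divDl p A k.
  have := logn_fact_geq k pp; lia.
apply: leq_trans S _; rewrite big1 // => j _.
apply/eqP; rewrite eqb0; apply: contraNN pr => pj.
by rewrite /rise (bigD1 j) //= dvdn_mulr.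
Qed.

(** Up to [a = K] the factor [K ^ K] suffices alone; beyond, each new factor of the factorial
    exceeds [K]. *)
Lemma exp_fact_leq K a : 0 < K -> K ^ a <= K ^ K * a`!.
Proof.
move=> K0; elim: a => [|a IHa]; first by rewrite muln1 expn_gt0 K0.
have [aK|aK] := leqP a.+1 K.
  by rewrite (leq_trans (leq_pexp2l K0 aK)) // leq_pmulr // fact_gt0.
rewrite expnS factS mulnCA; apply: leq_mul => //; lia.
Qed.

(** Since rad(x!)^q <= (4^q)^x, [exp_fact_leq] with [K = 4 ^ q] costs one constant per factorial,
    depending on [q] only. *)
Lemma rad_prod_fact_leq q (s : seq nat) :
  rad (\prod_(x <- s) x`!) ^ q <= ((4 ^ q) ^ (4 ^ q)) ^ size s * \prod_(x <- s) x`!.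
Proof.
set K := 4 ^ q; elim: s => [|x s IHs]; first by rewrite big_nil /rad big_nil exp1n.
rewrite !big_cons /= expnS mulnACA.
have H : rad x`! ^ q <= K ^ K * x`!.
  apply: leq_trans (exp_fact_leq x (_ : 0 < K)); last by rewrite expn_gt0.
  by rewrite -expnM mulnC expnM leq_wexp2r // rad_fact_leq.
apply: leq_trans (leq_mul H IHs).
by rewrite -expnMn leq_wexp2r // radM_leq ?fact_gt0 ?prod_fact_gt0.
Qed.

(** * Consequences of the abc conjecture *)

Lemma INR_expn m n : INR (m ^ n) = pow (INR m) n.
Proof. by elim: n => [|n IHn] //=; rewrite expnS -multE mult_INR IHn. Qed.

(** The triple 1 + x = x + 1, with fourth powers clearing the exponent 7/4. *)
Lemma abc_consecutive x : explicit_abc -> 0 < x ->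
  x.+1 ^ 4 <= (rad x * rad x.+1) ^ 7.
Proof.
move=> abc x0.
have H := abc (Z.pos xH) (Z.of_nat x) (Z.of_nat x.+1).
have {H}: Rlt (IZR (Z.of_nat x.+1))
   (Rpower (IZR (radZ (Z.mul (Z.mul (Z.pos xH) (Z.of_nat x)) (Z.of_nat x.+1))))
      (Rdiv (INR 7) (INR 4))).
  apply: H; try lia.
  - exact: Z.gcd_1_l.
  - exact: Z.gcd_1_l.
  - have -> : Z.of_nat x.+1 = Z.add (Z.pos xH) (Z.of_nat x) by lia.
    by rewrite Z.gcd_add_diag_r Z.gcd_1_r.
have -> : radZ (Z.mul (Z.mul (Z.pos xH) (Z.of_nat x)) (Z.of_nat x.+1))
   = Z.of_nat (rad (x * x.+1)).
  rewrite /radZ; congr (Z.of_nat (rad _)); lia.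
set r := rad _; rewrite -!INR_IZR_INZ => H.
have r0 : Rlt 0 (INR r) by apply: (lt_INR 0); have := rad_gt0 (x * x.+1); rewrite -/r; lia.
have : Rle (pow (INR x.+1) 4) (pow (INR r) 7).
  have -> : pow (INR r) 7 = pow (Rpower (INR r) (Rdiv (INR 7) (INR 4))) 4.
    rewrite -[in RHS]Rpower_pow; last exact: exp_pos.
    rewrite Rpower_mult -Rpower_pow //; congr Rpower.
    by rewrite /Rdiv Rmult_assoc Rinv_l ?Rmult_1_r //; apply: not_0_INR.
  by apply: pow_incr; split; [exact: pos_INR | exact: Rlt_le].
rewrite -!INR_expn => /INR_le /leP le47.
by apply: leq_trans le47 _; rewrite leq_exp2r // radM_leq.
Qed.

(** The first [2h] factors form [h] consecutive pairs, each contributing at least [A ^ 4]; the other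
    radicals are at least 1. *)
Lemma abc_rise A k h : explicit_abc -> h.*2 <= k ->
  A ^ (4 * h) <= (\prod_(j < k) rad (A + j.+1)) ^ 7.
Proof.
move=> abc hk; rewrite -(subnKC hk) big_split_ord /= expnMn.
rewrite -[X in X <= _]muln1; apply: leq_mul; last first.
  by rewrite expn_gt0 prodn_gt0 // => j; exact: rad_gt0.
elim: h {hk} => [|h IHh]; first by rewrite muln0 expn0 big_ord0 exp1n.
rewrite doubleS !big_ord_recr /= -mulnA mulnS addnC expnD expnMn.
apply: leq_mul IHh _.
rewrite [A + h.*2.+2]addnS; apply: leq_trans (abc_consecutive abc _) => //.
  by rewrite leq_exp2r // -addnS leq_addr.
by rewrite addnS.
Qed.

(** * Upper bounds for the gap k *)

Lemma sum_leq_logn2_fact L (s : seq nat) : all (fun x => x < 2 ^ L) s ->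
  \sum_(x <- s) x <= logn 2 (\prod_(x <- s) x`!) + size s * L.
Proof.
elim: s => [|x s IHs]; first by rewrite !big_nil.
move=> /andP[/leq_logn2_fact xL /IHs sL].
by rewrite !big_cons lognM ?fact_gt0 ?prod_fact_gt0 //= mulSn; lia.
Qed.

(** The geometric mean a!^(1/a) of 1, ..., a increases with a; powers replace the roots. *)
Lemma fact_exp_leq a A : a <= A -> a`! ^ A <= A`! ^ a.
Proof.
move=> /subnKC <-; elim: (A - a) => [|d IHd]; first by rewrite addn0.
rewrite addnS expnS factS expnMn; apply: leq_mul IHd.
by apply: leq_trans (fact_leq_exp _) _; apply: leq_wexp2r; lia.
Qed.

Lemma prod_fact_exp_leq A (s : seq nat) : all (fun x => x <= A) s ->
  (\prod_(x <- s) x`!) ^ A <= A`! ^ (\sum_(x <- s) x).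
Proof.
elim: s => [|x s IHs]; first by rewrite !big_nil exp1n.
move=> /andP[/fact_exp_leq xA /IHs sA].
by rewrite !big_cons expnMn expnD leq_mul.
Qed.

(* If n_2 <= n_1 - 2k, merging all a_j other than a_1 into one factorial loses
   little: the product is largest at (n_1 - k)! (n_2 + k + T)!. *)
Lemma gap_far A k n2 T (s : seq nat) : n2 + k <= A ->
  \sum_(x <- s) x <= n2 + k + T ->
  A`! * \prod_(x <- s) x`! = (A + k)`! * n2`! ->
  (A + k + k) ^ k <= (A + k) ^ k * (A + k + T) ^ T.
Proof.
move=> nA sT; rewrite fact_rise -mulnA => /eqP.
rewrite eqn_pmul2l ?fact_gt0 // => /eqP E.
have F : rise A k <= rise n2 k * (A + k + T) ^ T.
  have: rise A k * n2`! <= (n2 + k + T)`!.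
    rewrite -E (leq_trans (prod_fact_leq s)) //.
    by rewrite -(subnKC sT) fact_rise leq_pmulr // rise_gt0.
  rewrite -addnA fact_rise mulnC leq_pmul2l ?fact_gt0 // => /leq_trans; apply.
  rewrite rise_add leq_pmul2l ?rise_gt0 //.
  by apply: leq_trans (rise_leq _ _) _; apply: leq_wexp2r; lia.
rewrite -(leq_pmul2r (rise_gt0 n2 k)) -mulnA [_ ^ T * _]mulnC.
apply: leq_trans (leq_mul (leqnn _) F).
have X (x : nat) : x ^ k = \prod_(j < k) x by rewrite prod_nat_const card_ord.
(* Factorwise, (A + 2k)(n2 + j + 1) <= (A + k)(A + j + 1) because n2 <= A - k and j < k. *)
rewrite /rise !X -!big_split /=; apply: leq_prod => j _.
have := ltn_ord j; nia.
Qed.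

(** Opposite factors are paired: (A + j + 1)(A + k - j) >= A(A + k). *)
Lemma rise_sq_geq A k : A ^ k * (A + k) ^ k <= rise A k ^ 2.
Proof.
have X (x : nat) : x ^ k = \prod_(j < k) x by rewrite prod_nat_const card_ord.
rewrite expnS expn1 {2}/rise (reindex_inj rev_ord_inj) /= /rise !X -!big_split /=.
apply: leq_prod => j _; have := ltn_ord j; nia.
Qed.

(* If n_2 >= n_1 - 2k, use x! <= (A!)^(x/A) for x <= A instead, raised to the
   power A to stay in nat. *)
Lemma gap_near A k n2 T (s : seq nat) : 0 < A -> A <= n2 + k ->
  all (fun x => x <= A) s ->
  \sum_(x <- s) x <= A + k + n2 + T ->
  \prod_(x <- s) x`! = (A + k)`! * n2`! ->
  (A + k + k) ^ k <= (A + k) ^ k * (A + k) ^ (2 * T).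
Proof.
move=> A0 nA sA sT E.
(* The shift by [k] keeps [e] from truncating when [n2 < A], so that [Fn2] expresses n2! >= A! A^(n2
   - A) for either sign of the exponent. *)
set e := n2 + k - A.
have Fn2 : A`! * A ^ e <= n2`! * A ^ k.
  have [An|An] := leqP A n2.
    rewrite -(subnKC An) fact_rise -mulnA leq_pmul2l ?fact_gt0 //.
    have -> : e = (n2 - A) + k by lia.
    by rewrite expnD leq_mul // rise_geq.
  have -> : k = (A - n2) + e by lia.
  rewrite expnD mulnA; apply: leq_mul => //.
  rewrite -{1}(subnKC (ltnW An)) fact_rise leq_mul2l; apply/orP; right.
  by apply: leq_trans (rise_leq _ _) _; rewrite subnKC // ltnW.
(* The arguments sum to at most 2A + e + T: the part 2A accounts for (A!)^2, and each further unit
   costs at most a factor [A]. *)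
have F : rise A k <= A ^ (k + T).
  have G : 0 < A`! ^ 2 * A ^ e by rewrite muln_gt0 !expn_gt0 fact_gt0 A0.
  rewrite -(leq_pmul2l G) -(leq_exp2r _ _ A0).
  apply: (@leq_trans (((A + k)`! * (n2`! * A ^ k)) ^ A)).
    rewrite leq_exp2r // fact_rise.
    have -> : A`! ^ 2 * A ^ e * rise A k = A`! * rise A k * (A`! * A ^ e) by lia.
    by rewrite leq_mul2l Fn2 orbT.
  rewrite mulnA expnMn -E.
  have -> : (A`! ^ 2 * A ^ e * A ^ (k + T)) ^ A =
            A`! ^ (2 * A) * (A ^ A) ^ (e + T) * (A ^ k) ^ A.
    rewrite !expnMn -!expnM -!mulnA -!expnD mulnA -expnD.
    by congr (expn _ _ * expn A _); lia.
  rewrite leq_mul2r; apply/orP; right.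
  apply: leq_trans (prod_fact_exp_leq sA) _.
  apply: (@leq_trans (A`! ^ (2 * A + (e + T)))).
    by rewrite leq_pexp2l ?fact_gt0 //; lia.
  rewrite expnD leq_mul2l; apply/orP; right.
  exact: leq_wexp2r (fact_leq_exp A).
have k0 : 0 < k \/ k = 0 by lia.
case: k0 => [k0|->]; last by rewrite !expn0 mul1n expn_gt0; lia.
have H : (A + k) ^ k <= A ^ k * A ^ (2 * T).
  have Ak : 0 < A ^ k by rewrite expn_gt0 A0.
  rewrite -(leq_pmul2l Ak); apply: leq_trans (rise_sq_geq A k) _.
  rewrite -!expnD; have -> : k + (k + 2 * T) = (k + T) * 2 by lia.
  by rewrite expnM leq_exp2r.
have nk : 0 < (A + k) ^ k by rewrite expn_gt0; lia.
(* The inequality A(A + 2k) <= (A + k)^2 passes from the ratio (A + k)/A to (A + 2k)/(A + k). *)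
rewrite -(leq_pmul2l nk); apply: leq_trans (leq_mul H (leqnn _)) _.
rewrite mulnAC -expnMn mulnA; apply: leq_mul.
  by rewrite -expnMn leq_exp2r //; nia.
by rewrite leq_wexp2r // leq_addr.
Qed.

Lemma bernoulli_expn D m : D ^ m * (D + m) <= D.+1 ^ m * D.
Proof.
elim: m => [|m IHm]; first by rewrite addn0.
by rewrite !expnS; nia.
Qed.

(** As k/n >= 1/D, (1 + 1/D)^k <= M; Bernoulli's (1 + 1/D)^D >= 2 then gives 2^k <= M^D. *)
Lemma gap_exp_leq n k D M : 0 < n -> 0 < D -> n <= k * D ->
  (n + k) ^ k <= n ^ k * M -> 2 ^ n <= M ^ (D * D).
Proof.
move=> n0 D0 nkD H.
have nk : 0 < n ^ k by rewrite expn_gt0 n0.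
have k0 : 0 < k by case: (k) nkD => //; lia.
have H1 : D.+1 ^ k <= D ^ k * M.
  rewrite -(leq_pmul2l nk) mulnCA; apply: leq_trans (leq_mul (leqnn _) H).
  by rewrite -!expnMn leq_exp2r //; nia.
have B : 2 * D ^ D <= D.+1 ^ D.
  by rewrite -(leq_pmul2r D0) (leq_trans _ (bernoulli_expn D D)) //; lia.
have H2 : 2 ^ k <= M ^ D.
  have Dk : 0 < (D ^ D) ^ k by rewrite !expn_gt0 D0.
  rewrite -(leq_pmul2r Dk) -expnMn.
  apply: (@leq_trans ((D.+1 ^ D) ^ k)); first by rewrite leq_exp2r.
  by rewrite -!expnM [D * k]mulnC !expnM mulnC -expnMn leq_exp2r // mulnC.
apply: (@leq_trans (2 ^ (k * D))); first by rewrite leq_exp2l.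
by rewrite !expnM leq_exp2r.
Qed.

Lemma bin_leq_exp2 n m : 'C(n, m) <= 2 ^ n.
Proof.
have [mn|mn] := ltnP m n.+1; last by rewrite bin_small.
rewrite -[2]/(1 + 1) expnDn (bigD1 (Ordinal mn)) //= !exp1n !muln1.
exact: leq_addr.
Qed.

Lemma fact_add_leq k l : (k + l)`! <= 2 ^ (k + l) * (k`! * l`!).
Proof.
rewrite -(bin_fact (leq_addr l k)) addnC addnK addnC leq_mul2r.
by rewrite bin_leq_exp2 orbT.
Qed.

(** The product is at least A^k l! and at most (k + l + T)! <= 2^(k+l) k! l! W. After cancelling l!,
    A >= 2^(c+2) k leaves a surplus 2^k. *)
Lemma small_gap_exp_leq A k b l c T (s : seq nat) :
  0 < k -> k * 2 ^ c.+3 <= A + k -> l <= c * k ->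
  \sum_(x <- s) x <= k + l + T ->
  \prod_(x <- s) x`! = rise A k * rise b l ->
  2 ^ k <= (c.+1 * (A + k) + T) ^ T.
Proof.
move=> k0 kA lk sT E; set W := _ ^ T.
have H : rise A k * l`! <= 2 ^ (k + l) * (k`! * l`!) * W.
  apply: (@leq_trans (k + l + T)`!).
    apply: (@leq_trans (rise A k * rise b l)).
      by rewrite leq_mul2l rise_fact leq_rise ?orbT.
    rewrite -E (leq_trans (prod_fact_leq s)) //.
    by rewrite -(subnKC sT) fact_rise leq_pmulr // rise_gt0.
  rewrite fact_rise; apply: leq_mul; first exact: fact_add_leq.
  by apply: leq_trans (rise_leq _ _) _; apply: leq_wexp2r; nia.
have {}H : rise A k <= 2 ^ (k + l) * k`! * W.
  by rewrite -(leq_pmul2r (fact_gt0 l)); lia.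
have P : 0 < k ^ k * 2 ^ (c.+1 * k) by rewrite muln_gt0 !expn_gt0 k0.
rewrite -(leq_pmul2l P); apply: (@leq_trans (A ^ k)).
  rewrite expnM -!expnMn leq_exp2r //.
  by rewrite !expnS in kA *; have := expn_gt0 2 c; nia.
apply: leq_trans (rise_geq A k) _; apply: leq_trans H _.
rewrite leq_mul2r; apply/orP; right.
by rewrite mulnC leq_mul // ?fact_leq_exp // leq_exp2l //; nia.
Qed.

Lemma poly_leq_exp2 C d : exists L0, forall L, L0 <= L -> C * L ^ d <= 2 ^ L.
Proof.
(* With m = L / (d + 1) rounded down, 2^L >= (m + 1)^(d+1); this witness makes the extra factor m +
   1 absorb (d + 1)^d C. *)
exists (d.+1 * (d.+1 ^ d * C)) => L LL.
set m := L %/ d.+1.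
have Lm : L <= m.+1 * d.+1 by rewrite ltnW // ltn_ceil.
have mL : m * d.+1 <= L by exact: leq_trunc_div.
have mC : d.+1 ^ d * C <= m by rewrite leq_divRL // mulnC.
apply: (@leq_trans (m.+1 ^ d.+1)).
  rewrite expnS; apply: (@leq_trans (C * (m.+1 * d.+1) ^ d)).
    by rewrite leq_mul2l leq_wexp2r ?orbT.
  rewrite expnMn mulnCA mulnC leq_mul2r; apply/orP; right.
  by rewrite mulnC ltnW.
apply: (@leq_trans (2 ^ (m * d.+1))); last by rewrite leq_exp2l.
by rewrite expnM leq_exp2r // ltn_expl.
Qed.

(** * The bound on n *)

(** Let R be the radical of [rise A k] and h = k/2 rounded down. Replacing A by n and removing k!
    each cost at most n^h, so abc leaves n^(2h) <= R^7. But R^(7w) <= F n^(wh), whence n^(hw) <=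
    F. *)
Lemma abc_gap_bound A k b l c (s : seq nat) : explicit_abc ->
  1 < k -> k <= A -> b + l <= A + k -> l <= c * k ->
  16 <= A + k -> k ^ 21 <= A + k ->
  \prod_(x <- s) x`! = rise A k * rise b l ->
  A + k <= ((4 ^ (7 * (3 * c.+1))) ^ (4 ^ (7 * (3 * c.+1)))) ^ size s.
Proof.
move=> abc k1 kA bl lk; set n := A + k; set w := 3 * c.+1 => n16 kn E.
have := rad_prod_fact_leq (7 * w) s; set F := _ ^ size s; move: F => F HF.
have {}kn h : (k ^ 21) ^ h <= n ^ h by exact: leq_wexp2r.
set h := k./2; have kh : k <= 3 * h by lia.
have h0 : 0 < h by lia.
have hk : h.*2 <= k by lia.
set R := rad (rise A k).
have n0 : 0 < n by lia.
have HR : R ^ (7 * w) <= F * n ^ (w * h).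
  apply: (@leq_trans (F * \prod_(x <- s) x`!)).
    apply: leq_trans HF; apply: leq_wexp2r.
    by apply: dvdn_leq_rad; rewrite ?prod_fact_gt0 // E dvdn_mulr.
  rewrite leq_mul2l E; apply/orP; right.
  apply: (@leq_trans (n ^ k * n ^ l)).
    apply: leq_mul; first exact: rise_leq.
    by apply: leq_trans (rise_leq _ _) _; apply: leq_wexp2r.
  by rewrite -expnD leq_pexp2l //; nia.
(* The exponent 21 comes from 7k <= 21h. *)
have Hk : k`! ^ 7 <= n ^ h.
  apply: (@leq_trans ((k ^ 21) ^ h)); last exact: kn.
  apply: leq_trans (leq_wexp2r _ (fact_leq_exp k)) _.
  by rewrite -!expnM leq_pexp2l //; lia.
have H1 : n ^ (4 * h) <= n ^ h * (n ^ h * R ^ 7).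
  apply: (@leq_trans (2 ^ (4 * h) * A ^ (4 * h))).
    by rewrite -expnMn; apply: leq_wexp2r; lia.
  apply: leq_mul; first by rewrite expnM; exact: leq_wexp2r.
  apply: leq_trans (abc_rise A abc hk) _.
  apply: leq_trans (leq_wexp2r 7 (dvdn_leq _ (prod_rad_dvdn A k))) _.
    by rewrite muln_gt0 fact_gt0 rad_gt0.
  by rewrite expnMn leq_mul2r Hk orbT.
have H2 : n ^ (4 * h * w) <= n ^ (h * w) * (n ^ (h * w) * (F * n ^ (w * h))).
  rewrite expnM; apply: leq_trans (leq_wexp2r w H1) _.
  by rewrite 2!expnMn -!expnM; do 2!apply: leq_mul => //.
have N : 0 < n ^ (3 * (h * w)) by rewrite expn_gt0 n0.
apply: (@leq_trans (n ^ (h * w))).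
  by rewrite -{1}[n]expn1 leq_pexp2l // muln_gt0 h0.
rewrite -(leq_pmul2l N) -expnD.
have -> : 3 * (h * w) + h * w = 4 * h * w by lia.
apply: leq_trans H2 _; rewrite [w * h]mulnC [F * _]mulnC !mulnA -!expnD.
by rewrite leq_mul2r leq_pexp2l ?orbT //; lia.
Qed.

Lemma factorial_product_bound t c : explicit_abc ->
  exists B, forall A k b l (s : seq nat), size s = t ->
    all (fun x => x <= A) (b :: s) -> 1 < k -> b + l <= A + k -> l <= c * k ->
    A`! * (b`! * \prod_(x <- s) x`!) = (A + k)`! * (b + l)`! -> A + k <= B.
Proof.
(* [D] is the threshold of [small_gap_exp_leq]; [T'] counts the factorials on the left. *)
move=> abc; set D := 2 ^ c.+3; set T' := t.+2.
(* [L1] will contradict n = O(L^2), which follows if k > n/D; [L2] will turn k = O(L^2) into k^21 <=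
   n. *)
have [L1 HL1] := poly_leq_exp2 (2 * (T'.+1 * (2 * T') * (D * D)) + 1) 2.
have [L2 HL2] := poly_leq_exp2 (2 * ((T' + c).+1 * T') ^ 21) 42.
set F := ((4 ^ (7 * (3 * c.+1))) ^ (4 ^ (7 * (3 * c.+1)))) ^ t.
exists (maxn 16 (maxn (2 ^ maxn L1 L2) F)) => A k b l s st /andP[bA sA] k1 bl lk E.
set n := A + k; rewrite leqNgt; apply/negP; rewrite !gtn_max => /and3P[n16 nL nF].
set L := (trunc_log 2 n).+1; set T := T' * L.
have n0 : 0 < n by lia.
have /andP[Ln nL'] := trunc_log_bounds (isT : 1 < 2) n0.
have L2n : 2 ^ L <= 2 * n by rewrite expnS leq_mul2l.
have LL : maxn L1 L2 < L by rewrite -(ltn_exp2l _ _ (isT : 1 < 2)) (ltn_trans nL).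
rewrite -/L in nL'.
move: LL; rewrite gtn_max => /andP[LL1 LL2].
have Lexp : L < 2 ^ L by rewrite ltn_expl.
(* If [A = 0], all arguments on the left vanish and k! l! = 1, against k >= 2. *)
have A0 : 0 < A.
  rewrite lt0n; apply/eqP => A0; move: E bA sA; rewrite A0 leqn0 => E /eqP b0 sA.
  have S0 : \prod_(x <- s) x`! = 1.
    by rewrite big_seq big1 // => x /(allP sA); rewrite leqn0 => /eqP->.
  rewrite S0 b0 !add0n fact0 in E.
  have := fact_geq k; have := fact_gt0 l; nia.
have prodE : \prod_(x <- [:: A, b & s]) x`! = n`! * (b + l)`! by rewrite !big_cons.
(* Both sides of [prodE] have the same 2-adic valuation. *)
have sumE : A + (b + \sum_(x <- s) x) <= n + (b + l) + T.
  have -> : A + (b + \sum_(x <- s) x) = \sum_(x <- [:: A, b & s]) x by rewrite !big_cons.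
  apply: (@leq_trans (logn 2 (\prod_(x <- [:: A, b & s]) x`!) + T)).
    have -> : T = size [:: A, b & s] * L by rewrite /= st.
    apply: sum_leq_logn2_fact => /=; apply/and3P; split; try lia.
    by apply: sub_all sA => x xA; lia.
  rewrite leq_add2r prodE lognM ?fact_gt0 // leq_add //; exact: logn2_fact_leq.
have T1 : forall d, d.+1 * n + T <= 2 ^ (L + T' + d).
  move=> d; apply: (@leq_trans ((d.+1 + T') * 2 ^ L)); first by rewrite /T; nia.
  rewrite [L + T']addnC -addnA [_ + d]addnC addnA expnD leq_mul2r; apply/orP; right.
  by have := ltn_expl (T' + d) (isT : 1 < 2); lia.
have kD : k * D <= n.
  rewrite leqNgt; apply/negP => /ltnW nkD.
  have G : (n + k) ^ k <= n ^ k * (n + T) ^ (2 * T).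
    have [nA|nA] := leqP (b + l + k) A.
      apply: (@leq_trans (n ^ k * (n + T) ^ T)).
        apply: (gap_far (n2 := b + l) (s := b :: s)) => //.
        - by rewrite big_cons; lia.
        - by rewrite big_cons.
      by rewrite leq_mul2l leq_pexp2l ?orbT //; lia.
    apply: (@leq_trans (n ^ k * n ^ (2 * T))).
      apply: (gap_near (n2 := b + l) (s := [:: A, b & s])) => //.
      - exact: ltnW.
      - by rewrite /= leqnn bA.
      - by rewrite !big_cons; lia.
    by rewrite leq_mul2l leq_wexp2r ?orbT // leq_addr.
  have D0 : 0 < D by rewrite expn_gt0.
  have := gap_exp_leq n0 D0 nkD G.
  have nT : n + T <= 2 ^ (L + T') by have := T1 0; rewrite mul1n addn0.
  move=> /leq_trans /(_ (leq_wexp2r _ (leq_wexp2r _ nT))).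
  rewrite -!expnM leq_exp2l // => X.
  have := HL1 L (ltnW LL1).
  have Y : (L + T') * (2 * T) * (D * D) <= T'.+1 * (2 * T') * (D * D) * L ^ 2.
    rewrite /T; have -> : T'.+1 * (2 * T') * (D * D) * L ^ 2 =
      (T'.+1 * L) * (2 * (T' * L)) * (D * D) by lia.
    by rewrite !leq_mul //; nia.
  have : 0 < L ^ 2 by rewrite expn_gt0.
  lia.
have kA : k <= A by rewrite /D !expnS in kD; have := expn_gt0 2 c; nia.
have E' : \prod_(x <- s) x`! = rise A k * rise b l.
  apply/eqP; rewrite -(eqn_pmul2l (fact_gt0 b)) -(eqn_pmul2l (fact_gt0 A)) E.
  by rewrite !fact_rise; apply/eqP; lia.
have kL : k <= (L + T' + c) * T.
  have : 2 ^ k <= (c.+1 * n + T) ^ T.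
    by apply: (small_gap_exp_leq (b := b) (l := l) (s := s)) => //; lia.
  by move=> /leq_trans /(_ (leq_wexp2r _ (T1 c))); rewrite -expnM leq_exp2l.
have k21 : k ^ 21 <= n.
  have K : k <= (T' + c).+1 * T' * L ^ 2 by apply: leq_trans kL _; rewrite /T; nia.
  rewrite -(leq_pmul2l (isT : 0 < 2)); apply: leq_trans L2n.
  apply: leq_trans (HL2 L (ltnW LL2)); rewrite -mulnA leq_mul2l /=.
  have K21 := leq_wexp2r 21 K.
  by rewrite (expnMn _ (L ^ 2) 21) -(expnM L 2 21) in K21.
move: nF; rewrite ltnNge => /negP; apply; rewrite /F -st.
by apply: abc_gap_bound E' => //; exact: ltnW.
Qed.

(** * Finiteness of the solution sets *)

(** Taking out [a_1] and [a_i] leaves [t.-2] factorials, so the bound is uniform in [i]. *)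
Lemma Nc_i_bound t c : explicit_abc ->
  exists B, forall i a n1 n2, 1 <= i < t -> Nc_i t c i a n1 n2 -> n1 <= B.
Proof.
move=> /(factorial_product_bound t.-2 c)[B HB]; exists B => i a n1 n2 it.
case=> /and5P[/eqP sz srt _ n21 /and3P[_ _ /eqP E]] [nt [an1 [bn2 ratio]]].
case: a sz srt E nt an1 bn2 ratio => [|A r] /=; first by lia.
move=> sz srt; rewrite big_cons => E /andP[/andP[nA _] _] An1.
case: i it => // i it /=; set b := nth 0 r i => bn2 ratio.
have ir : i < size r by move: it; rewrite -sz /= !ltnS.
have br : b \in r by rewrite mem_nth.
have pe := perm_to_rem br.
have rA : all (fun x => x <= A) r.
  by move: srt; rewrite path_sortedE => [/andP[]//|x y z] /=; lia.
(* Nontriviality enters here: it excludes n_1 - a_1 = 1. *)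
have k1 : 1 < n1 - A by move: nA; rewrite /dist1; lia.
rewrite -(subnKC (ltnW An1)).
apply: (HB _ _ b (n2 - b) (rem b r)).
- by rewrite size_rem // -sz.
- by rewrite -(perm_all _ pe).
- by [].
- by rewrite !subnKC // ltnW.
- move: ratio; rewrite Num.Theory.ler_pdivrMr; last by rewrite ltr0z; lia.
  by rewrite -intrM ler_int; lia.
- by rewrite !subnKC ?(ltnW An1) ?(ltnW bn2) // -E (perm_big _ pe) big_cons.
Qed.

Lemma finite_sols_bounded t B (P : seq nat -> nat -> nat -> Prop) :
  (forall a n1 n2, P a n1 n2 -> [/\ size a = t, all (fun x => x <= B) a,
     n1 <= B & n2 <= B]) -> finite_sols P.
Proof.
move=> H; exists [seq (map val (val u.1), val u.2.1, val u.2.2) |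
  u : t.-tuple 'I_B.+1 * ('I_B.+1 * 'I_B.+1)] => a n1 n2 /H[sa aB n1B n2B].
have sz : size (map (@inord B) a) == t by rewrite size_map sa.
apply/mapP; exists (Tuple sz, (inord n1, inord n2)); first exact: mem_enum.
rewrite /= !inordK //; congr (_, _, _).
rewrite -map_comp map_id_in // => x /(allP aB) xB.
by rewrite /= inordK.
Qed.

Theorem theorem1p1 :
  explicit_abc ->
  forall t c : nat, (3 <= t)%N -> (0 < c)%N ->
    (forall i : nat, (1 <= i < t)%N -> finite_sols (Nc_i t c i)) /\
    finite_sols (fun a n1 n2 => exists2 i : nat, (1 <= i < t)%N & Nc_i t c i a n1 n2).
Proof.
move=> abc t c _ _; have [B HB] := Nc_i_bound t c abc.
(* Since [B] is independent of [i], one list serves the union and each of its members. *)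
have [L HL] : finite_sols (fun a n1 n2 => exists2 i, 1 <= i < t & Nc_i t c i a n1 n2).
  apply: (finite_sols_bounded (t := t) (B := B)) => a n1 n2 [i it Na].
  have n1B := HB _ _ _ _ it Na.
  case: Na => /and5P[/eqP sz srt _ n21 _] [_ [an1 _]].
  split => //; last exact: leq_trans n21 n1B.
  case: a sz srt an1 => [|A r] //= _; rewrite path_sortedE => [|x y z] /=; last by lia.
  move=> /andP[rA _] An1; apply/andP; split; first by lia.
  by apply: sub_all rA => x /= xA; lia.
split; last by exists L.
by move=> i it; exists L => a n1 n2 Na; apply: HL; exists i.
Qed.
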